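(* Let $\ell=\lceil k/2\rceil$. (1) For odd $k$, the number of L-matchings of $X_{2k}$ of size $k$ is $\frac{2}{3}\cdot\frac{\ell-1}{\ell}\binom{4\ell-2}{\ell-1}$. (2) For even $k$, the number of L-matchings of $X_{2k}$ of size $k$ is $\frac{\ell+1}{3\ell+1}\binom{4\ell}{\ell}$.
   Context: Let $k\ge 1$ and let $X_{2k}=\{P_1,\dots,P_{2k}\}$ be $2k$ points in convex position in the plane, labeled in clockwise cyclic order; indices are taken modulo $2k$. A matching of $X_{2k}$ means a set of $k$ pairwise non-crossing straight segments (edges) with endpoints in $X_{2k}$ covering every point exactly once; its size is $k$. Matchings with different labels are counted as different. The rings of $X_{2k}$ ($k\ge 2$) are the two matchings consisting only of edges between consecutive points: $\{P_1P_2,P_3P_4,\dots,P_{2k-1}P_{2k}\}$ and $\{P_2P_3,P_4P_5,\dots,P_{2k}P_1\}$. A block of a matching $M$ is a pair of edges $\{P_iP_{i+3},P_{i+1}P_{i+2}\}\subseteq M$. If $K$ is a block of a matching $N$ of size $k+2$, then $N-K$ denotes the set $N\setminus K$, regarded as a matching of the remaining $2k$ points (which are in convex position) with their inherited cyclic order, i.e. as a matching of size $k$ defined up to cyclic relabeling. L-matchings are defined recursively: a matching of size $2$ or $3$ is an L-matching iff it is a ring; no matching of size $1$ is an L-matching; for $k\ge 4$, a matching $N$ of size $k$ is an L-matching iff it has a block $K$ such that $N-K$ is an L-matching. *)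

(* Defs.v *)
From HB Require Import structures.
From mathcomp Require Import all_boot all_order all_algebra.
Set Implicit Arguments. Unset Strict Implicit. Unset Printing Implicit Defensive.

(* Points P_1..P_n (clockwise) are labelled 0..n-1.  A matching is encoded by
   its partner sequence s : s`_i is the label of the point matched with i. *)

Definition is_perfect_matching (n : nat) (s : seq nat) : bool :=
  (size s == n) &&
  all (fun i => [&& nth 0 s i < n, nth 0 s i != i & nth 0 s (nth 0 s i) == i])
      (iota 0 n).

(* straight segments between points in convex position cross iff their
   endpoints interleave in the cyclic order *)
Definition noncrossing (n : nat) (s : seq nat) : bool :=
  all (fun a => all (fun b => all (fun c => all (fun d =>
        ~~ [&& a < b, b < c, c < d, nth 0 s a == c & nth 0 s b == d])
      (iota 0 n)) (iota 0 n)) (iota 0 n)) (iota 0 n).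

Definition is_matching (n : nat) (s : seq nat) : bool :=
  is_perfect_matching n s && noncrossing n s.

(* the two rings: {P1P2, P3P4, ...} (labels {0,1},{2,3},...) and
   {P2P3, ..., P_{2k}P_1} (labels {1,2},...,{n-1,0}) *)
Definition is_ring (n : nat) (s : seq nat) : bool :=
  all (fun i => nth 0 s i == (if odd i then i.-1 else i.+1)) (iota 0 n) ||
  all (fun i => nth 0 s i == (if odd i then i.+1 %% n else (i + n).-1 %% n))
      (iota 0 n).

Definition has_block_at (n : nat) (s : seq nat) (i : nat) : bool :=
  (nth 0 s (i %% n) == (i + 3) %% n) && (nth 0 s ((i + 1) %% n) == (i + 2) %% n).

(* N - K : remove the points i,...,i+3 and relabel the remaining points in
   their inherited cyclic order, starting from the point i+4. *)
Definition remove_block (n : nat) (s : seq nat) (i : nat) : seq nat :=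
  let q := (i + 4) %% n in
  [seq (nth 0 s ((q + j) %% n) + n - q) %% n | j <- iota 0 (n - 4)].

Fixpoint isLk (k : nat) (s : seq nat) : bool :=
  match k with
  | 0 | 1 => false
  | 2 | 3 => is_ring k.*2 s
  | k'.+2 => has (fun i => has_block_at k.*2 s i && isLk k' (remove_block k.*2 s i))
                 (iota 0 k.*2)
  end.

Definition mseq (n : nat) (f : {ffun 'I_n -> 'I_n}) : seq nat :=
  [seq val (f i) | i <- enum 'I_n].

Definition num_L_matchings (k : nat) : nat :=
  #|[set f : {ffun 'I_k.*2 -> 'I_k.*2} |
      is_matching k.*2 (mseq f) && isLk k (mseq f)]|.

(* Main.v *)
Require Import Defs.
From HB Require Import structures.
From mathcomp Require Import all_boot all_order all_algebra.
From mathcomp Require Import zify ring.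
Import GRing.Theory Num.Theory.

(** Mark some of the points by U and the others by d, and call a matching
compatible with this cyclic word if it can be reduced by removing blocks that
read Uddd.  A word with [m] marks among [4 m] letters reduces to the empty word
and has exactly one compatible matching; a word with [m] marks among [4 m + 4]
or [4 m + 6] letters reduces to 4 or 6 unmarked points, which carry two rings,
so it has exactly two.  Conversely, fix an L-matching and one of its blocks: in
a compatible word either the block reads Uddd, which leaves a word compatible
with the smaller matching, or it reads ddUd (words reducing to the empty one) or
dddd (words reducing to a ring of size 2), and erasing the mark exchanges these
two exceptional cases.  By induction an L-matching of odd size has one word
reducing to a ring, and one of even size has one more word reducing to the empty
word than to a ring.  Hence the counts [2 'C(2k, (k - 3)/2)] for odd [k] and
['C(2k, k/2) - 2 'C(2k, k/2 - 1)] for even [k]. *)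

(** * Cyclic reduction of words *)

Section Reducible.
Context {T : Type} (blk : T -> T -> T -> T -> bool) (base : pred (seq T)).

(** Removing a block drops four letters, so the length of a word is enough fuel for its reduction;
    [rot i] brings to the front a window that may wrap around the end. *)
Fixpoint reducible_fuel (m : nat) (s : seq T) : bool :=
  base s || if m is m'.+1 then
    has (fun i => if rot i s is [:: a, b, c, d & t]
                  then blk a b c d && reducible_fuel m' t else false)
        (iota 0 (size s))
  else false.

Definition reducible (s : seq T) : bool := reducible_fuel (size s) s.

Lemma reducible_fuelE m s : size s <= m -> reducible_fuel m s = reducible s.
Proof.
suff fuel m1 m2 r : size r <= m1 -> size r <= m2 ->
    reducible_fuel m1 r = reducible_fuel m2 r by move=> sm; exact: fuel.
elim: m1 m2 r => [|m1 IH] [|m2] r r1 r2 //.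
- by rewrite (size0nil (_ : size r = 0)) //; lia.
- by rewrite (size0nil (_ : size r = 0)) //; lia.
rewrite [LHS]/= [RHS]/=; congr (_ || _).
apply: eq_has => i; have := size_rot i r.
by case: (rot i _) => [|a [|b [|c [|d t]]]] //= st; congr (_ && _); apply: IH; lia.
Qed.

Lemma reducibleE s :
  reducible s = base s || has (fun i =>
    if rot i s is [:: a, b, c, d & t] then blk a b c d && reducible t else false)
    (iota 0 (size s)).
Proof.
rewrite -(@reducible_fuelE (size s).+1) //=; congr (_ || _).
apply: eq_has => i; have := size_rot i s.
case: (rot i _) => [|a [|b [|c [|d t]]]] //= st.
by rewrite reducible_fuelE //; lia.
Qed.

Lemma reducibleP s :
  reflect (base s \/ exists i a b c d t,
      [/\ i < size s, rot i s = [:: a, b, c, d & t], blk a b c d & reducible t])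
    (reducible s).
Proof.
rewrite reducibleE; apply: (iffP orP) => -[bs|]; try by left.
  move=> /hasP[i]; rewrite mem_iota /= => si.
  case E1: (rot i s) => [|a [|b [|c [|d t]]]] // /andP[bl rt].
  by right; exists i, a, b, c, d, t.
move=> [i [a [b [c [d [t [si E1 bl rt]]]]]]]; right; apply/hasP.
by exists i; rewrite ?mem_iota // E1 bl.
Qed.

Lemma reducible_base s : base s -> reducible s.
Proof. by move=> bs; apply/reducibleP; left. Qed.

Lemma reducible_step i s a b c d t :
  rot i s = [:: a, b, c, d & t] -> blk a b c d -> reducible t -> reducible s.
Proof.
move=> E bl rt; apply/reducibleP; right.
have [si|si] := ltnP i (size s); first by exists i, a, b, c, d, t.
exists 0, a, b, c, d, t; rewrite rot0; split=> //; last by rewrite -E rot_oversize.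
by rewrite -(size_rot i) E.
Qed.

Lemma reducible_cons a b c d t :
  blk a b c d -> reducible t -> reducible [:: a, b, c, d & t].
Proof. by apply: (@reducible_step 0); rewrite rot0. Qed.

Lemma reducible_mod r :
  (forall s, base s -> size s = r %[mod 4]) ->
  forall s, reducible s -> size s = r %[mod 4].
Proof.
move=> br s; have [n] := ubnP (size s); elim: n s => // n IH s sn.
move=> /reducibleP[/br-> //|[i [a [b [c [d [t [_ E _ rt]]]]]]]].
have := size_rot i s; rewrite E /= => st; rewrite -(IH t) //; last by lia.
by rewrite -st -addn4 modnDr.
Qed.

Context (base_rot : forall i s, base (rot i s) = base s).

Lemma reducible_rot i s : reducible (rot i s) = reducible s.
Proof.
(* Rotations compose modulo the length, so every window of [r] is also a window of [rot j r]. *)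
have back j (r : seq T) k : exists k', rot k' (rot j r) = rot k r.
  have [rk|rk] := leqP k (size r); last first.
    by rewrite (rot_oversize (ltnW rk)); exists (size (rot j r) - j); exact: (rotK _).
  rewrite -{2}[r](rotK j) /rotr rot_add_mod ?size_rot ?leq_subr //.
  by eexists.
suff imp j (r : seq T) : reducible r -> reducible (rot j r).
  by apply/idP/idP => [/(imp (size (rot i s) - i))|/imp]; rewrite ?[rot (_ - _) _]rotK.
move=> /reducibleP[br|[k [a [b [c [d [t [_ E bl rt]]]]]]]].
  by apply: reducible_base; rewrite base_rot.
by have [k' E'] := back j r k; apply: (@reducible_step k') bl rt; rewrite E'.
Qed.

Lemma reducible_catC s t : reducible (s ++ t) = reducible (t ++ s).
Proof. by rewrite -(reducible_rot (size s)) rot_size_cat. Qed.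

Lemma reducible_insert s a b c d t :
  blk a b c d -> reducible (s ++ t) -> reducible (s ++ [:: a, b, c, d & t]).
Proof.
move=> bl; rewrite reducible_catC => rt; rewrite reducible_catC.
exact: reducible_cons.
Qed.

End Reducible.

Lemma rot_invariant T (P : pred (seq T)) :
  (forall s, P (rot 1 s) = P s) -> forall i s, P (rot i s) = P s.
Proof.
move=> P1; elim=> [|i IH] s; first by rewrite rot0.
have [si|si] := ltnP i (size s); first by rewrite rotS // P1.
by rewrite rot_oversize // ltnW.
Qed.

(** This serves twice: to replace [p] by a function that agrees with it on the labels, and to
    relabel the points left by a removed block. *)
Lemma reducible_map T T' (g : T' -> T) (P : pred T')
    (blk : T -> T -> T -> T -> bool) (base : pred (seq T)) blk' base' :
  (forall a b c d, P a -> P b -> P c -> P d ->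
     blk (g a) (g b) (g c) (g d) = blk' a b c d) ->
  (forall s, all P s -> base (map g s) = base' s) ->
  forall s, all P s -> reducible blk base (map g s) = reducible blk' base' s.
Proof.
move=> bl bs s; rewrite /reducible size_map; move: (size s) => m.
elim: m s => [|m IH] s Ps /=; first by rewrite bs.
rewrite size_map bs //; congr (_ || _); apply: eq_has => i; rewrite -map_rot.
have : all P (rot i s) by rewrite all_cat andbC -all_cat cat_take_drop.
case: (rot i s) => [|a [|b [|c [|d t]]]] //= /and5P[Pa Pb Pc Pd Pt].
by rewrite bl // IH.
Qed.

(** The shift [i] is compared with 4 and with [size s - 4]. The second case is that of disjoint
    windows, whose common remainder [A], [B] lets the two removals commute; the last two cases are
    the overlaps in either direction. *)
Lemma rot_blocks T i (a b c d : T) t a' b' c' d' t' :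
  let s := [:: a, b, c, d & t] in let s' := [:: a', b', c', d' & t'] in
  i < size s -> rot i s = s' ->
  [\/ s = s',
      exists A B, t = A ++ [:: a', b', c', d' & B] /\ t' = B ++ [:: a, b, c, d & A],
      exists2 j, 0 < j < 4 & rot j s = s' |
      exists2 j, 0 < j < 4 & rot j s' = s].
Proof.
move=> s s' si E.
case: (posnP i) => [i0|i0]; first by apply: Or41; rewrite -E i0 rot0.
have [i4|i4] := ltnP i 4; first by apply: Or43; exists i; rewrite ?i0.
have [n4|n4] := ltnP (size s - i) 4.
  apply: Or44; exists (size s - i); first by rewrite subn_gt0 si.
  by rewrite -E -{1}(size_rot i s); exact: (rotK _).
apply: Or42; case: i i0 i4 si n4 E => [|[|[|[|i]]]] //= _ _ si n4.
rewrite /rot /s /s' /=.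
have := size_drop i t; have := cat_take_drop i t.
case: (drop i t) => [|x1 [|x2 [|x3 [|x4 B]]]] /= tE sB; try by move: n4 sB; lia.
by case=> <- <- <- <- <-; exists (take i t), B.
Qed.

Arguments reducibleP {T blk base s}.
Arguments rot_blocks {T i a b c d t a' b' c' d' t'}.

(** * Matchings and marked words *)

(** Both directions are tested because [p] ranges over arbitrary functions on labels. *)
Definition linked (p : nat -> nat) x y := (p x == y) && (p y == x).

Definition nested p a b c d := linked p a d && linked p b c.

Definition ring p (s : seq nat) : bool :=
  match s with
  | [:: a; b; c; d] =>
      linked p a b && linked p c d || linked p b c && linked p d a
  | [:: a; b; c; d; e; f] =>
      [&& linked p a b, linked p c d & linked p e f]
      || [&& linked p b c, linked p d e & linked p f a]
  | _ => false
  end.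

(** A letter is a label paired with its mark, so this is a block of [p] that reads Uddd. *)
Definition opened p (x y z w : nat * bool) :=
  nested p x.1 y.1 z.1 w.1 && [&& x.2, ~~ y.2, ~~ z.2 & ~~ w.2].

Definition unmarked : pred (seq (nat * bool)) := all (fun x => ~~ x.2).

Definition unmarked_ring p (s : seq (nat * bool)) :=
  ring p (map fst s) && unmarked s.

Notation L_reducible p := (reducible (nested p) (ring p)).
Notation closed_word p := (reducible (opened p) (@nilp _)).
Notation ringed_word p := (reducible (opened p) (unmarked_ring p)).

Lemma linkedC p x y : linked p x y = linked p y x.
Proof. exact: andbC. Qed.

Lemma ring_rot p i s : ring p (rot i s) = ring p s.
Proof.
apply: rot_invariant => {i} {}s.
case: s => [|a [|b [|c [|d [|e [|f [|g s]]]]]]] //=; last by case: s.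
- by rewrite orbC (andbC (linked p c d)).
- by rewrite orbC andbA andbC.
Qed.

Lemma unmarked_rot i s : unmarked (rot i s) = unmarked s.
Proof. by rewrite /unmarked all_cat andbC -all_cat cat_take_drop. Qed.

Lemma unmarked_ring_rot p i s : unmarked_ring p (rot i s) = unmarked_ring p s.
Proof. by rewrite /unmarked_ring map_rot ring_rot unmarked_rot. Qed.

Lemma nilp_rot T i (s : seq T) : nilp (rot i s) = nilp s.
Proof. by rewrite /nilp size_rot. Qed.

Lemma ring_size p s : ring p s -> size s = 4 \/ size s = 6.
Proof. by case: s => [|? [|? [|? [|? [|? [|? [|? ?]]]]]]] //=; auto. Qed.

Lemma L_reducible_size p s : L_reducible p s -> 4 <= size s.
Proof.
move=> /reducibleP[/ring_size[]->//|[i [a [b [c [d [t [_ E _ _]]]]]]]].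
by rewrite -(size_rot i) E.
Qed.

Lemma ringed_word_size p s : ringed_word p s -> 4 <= size s.
Proof.
move=> /reducibleP[/andP[/ring_size]|[i [a [b [c [d [t [_ E _ _]]]]]]]].
  by rewrite size_map => -[]->.
by rewrite -(size_rot i) E.
Qed.

Lemma closed_word_size p s : closed_word p s -> 4 %| size s.
Proof.
by move=> Cs; rewrite /dvdn (reducible_mod _ _ 0 _ s Cs) // => r /nilP->.
Qed.

(** Confluence: wherever a word reads Uddd, every compatible [p] has a block there. Another
    removable window is either disjoint, and then the two removals commute, or it overlaps, and then
    the marked head of one window would be an unmarked letter of the other. *)
Lemma reducible_opened_inv p (base : pred (seq (nat * bool))) a b c d t :
  (forall i s, base (rot i s) = base s) -> (forall s, base s -> unmarked s) ->
  reducible (opened p) base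
    [:: (a, true), (b, false), (c, false), (d, false) & t] ->
  nested p a b c d /\ reducible (opened p) base t.
Proof.
move=> base_rot base_un; have [n] := ubnP (size t); elim: n t => // n IH t tn.
move=> /reducibleP[/base_un //|[i [a' [b' [c' [d' [t' [si E bl rt]]]]]]]].
case: (rot_blocks si E) => {si E}.
- by case=> *; subst; move: bl => /andP[].
- move=> [A [B [tE t'E]]]; subst.
  rewrite reducible_catC // in rt.
  have [||ne r] := IH (A ++ B); rewrite ?size_cat //=.
    by move: tn; rewrite size_cat /=; lia.
  by split=> //; apply: reducible_insert.
- move=> [j j4 /(congr1 (head (0, true))) E]; move: bl => /andP[_ /andP[+ _]].
  by rewrite -[a']E; case: j j4 {E} => [|[|[|[|j]]]].
- move=> [j j4 /(congr1 (head (0, true))) E].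
  move: bl => /andP[_ /and4P[_]]; case: a' b' c' d' E => [? ?] [? ?] [? ?] [? ?].
  by case: j j4 => [|[|[|[|j]]]] //= _ [_ ->].
Qed.

(** The shifted window begins at one of [b], [c], [d], whose partner lies in the first block, but it
    ends at one of the three letters after that block. With at least seven letters these three are
    new, a contradiction. *)
Lemma nested_overlap p j a b c d t a' b' c' d' t' :
  uniq [:: a, b, c, d & t] -> 2 < size t ->
  nested p a b c d -> nested p a' b' c' d' -> 0 < j < 4 ->
  rot j [:: a, b, c, d & t] <> [:: a', b', c', d' & t'].
Proof.
case: t => [|x [|y [|z t]]] // U _ /andP[/andP[/eqP ad /eqP da] /andP[/eqP bc /eqP cb]].
move=> /andP[/andP[/eqP ad' _] _] j4 E.
have : d' \notin [:: a; b; c; d].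
  move: U; rewrite -[[:: a, b, c, d & _]]/([:: a; b; c; d] ++ [:: x, y, z & t]).
  rewrite cat_uniq => /and3P[_ /hasPn/(_ d') H _]; apply: H.
  by case: j j4 E => [|[|[|[|j]]]] //= _; rewrite /rot /= => -[]*; subst; rewrite !inE eqxx ?orbT.
apply/negP/negPn; rewrite -ad'.
case: j j4 E => [|[|[|[|j]]]] //= _; rewrite /rot /= => -[<- *];
  by rewrite ?bc ?cb ?da !inE eqxx ?orbT.
Qed.

(* Blocks of one matching cannot overlap on 7 points or more. *)
Lemma reducible_nested_inv p (base : pred (seq (nat * bool))) a b c d t :
  (forall i s, base (rot i s) = base s) ->
  uniq (map fst [:: a, b, c, d & t]) -> nested p a.1 b.1 c.1 d.1 -> 2 < size t ->
  reducible (opened p) base [:: a, b, c, d & t] ->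
  [\/ base [:: a, b, c, d & t],
      opened p a b c d /\ reducible (opened p) base t |
      exists A x y z w B, [/\ t = A ++ [:: x, y, z, w & B], opened p x y z w &
        reducible (opened p) base ([:: a, b, c, d & A ++ B])]].
Proof.
move=> base_rot U ne t2.
move=> /reducibleP[bs|[i [a' [b' [c' [d' [t' [si E bl rt]]]]]]]]; first exact: Or31.
have ne' : nested p a'.1 b'.1 c'.1 d'.1 by case/andP: bl.
have st : size t = size t' by have := size_rot i [:: a, b, c, d & t]; rewrite E => -[].
have U' : uniq (map fst [:: a', b', c', d' & t']) by rewrite -E map_rot rot_uniq.
case: (rot_blocks si E) => {si E}.
- by case=> *; subst; apply: Or32.
- move=> [A [B [tE t'E]]]; apply: Or33; exists A, a', b', c', d', B; split=> //.
  by move: rt; rewrite t'E reducible_catC.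
- move=> [j j4 E]; case: (@nested_overlap p j _ _ _ _ _ _ _ _ _ (map fst t') U _ ne ne' j4).
    by rewrite size_map.
  by move/(congr1 (map fst)): E; rewrite map_rot.
- move=> [j j4 E]; case: (@nested_overlap p j _ _ _ _ _ _ _ _ _ (map fst t) U' _ ne' ne j4).
    by rewrite size_map -st.
  by move/(congr1 (map fst)): E; rewrite map_rot.
Qed.

Lemma nested_inj p a b c d :
  uniq [:: a; b; c; d] -> nested p a b c d ->
  (linked p a b = false) * (linked p b a = false) *
  (linked p c d = false) * (linked p d c = false) *
  (linked p a c = false) * (linked p c a = false) *
  (linked p b d = false) * (linked p d b = false).
Proof.
rewrite /= !inE !negb_or -!andbA => /and5P[ab ac ad bc /andP[bd /andP[cd _]]].
move=> /andP[/andP[/eqP pad /eqP pda] /andP[/eqP pbc /eqP pcb]].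
rewrite /linked pad pda pbc pcb.
do ![rewrite eq_sym (negbTE cd) | rewrite (negbTE cd)] => /=.
by rewrite !(eq_sym _ a) !(eq_sym d _) ?(negbTE ab) ?(negbTE ac) ?(negbTE bd) ?(negbTE cd) ?andbF.
Qed.

Lemma uniq_skip (T : eqType) (s1 s2 s3 : seq T) :
  uniq (s1 ++ s2 ++ s3) -> uniq (s1 ++ s3).
Proof. by apply/subseq_uniq/cat_subseq => //; apply: suffix_subseq. Qed.

(** Removals away from the given block commute with it, so the induction comes down to the block
    alone. Four cyclic points can be read as a block from [a] or from [c], which gives the readings
    Uddd and ddUd. *)
Lemma closed_word_nested_inv p (a b c d : nat) w1 w2 w3 w4 (t : seq (nat * bool)) :
  uniq [:: a, b, c, d & map fst t] -> nested p a b c d ->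
  closed_word p [:: (a, w1), (b, w2), (c, w3), (d, w4) & t] ->
  [:: w1; w2; w3; w4] = [:: true; false; false; false] /\ closed_word p t \/
  [:: w1; w2; w3; w4] = [:: false; false; true; false] /\
    ringed_word p [:: (a, false), (b, false), (c, false), (d, false) & t].
Proof.
move=> + ne; have [n] := ubnP (size t); elim: n t => // n IH t tn U Ct.
have [t2|t2] := ltnP 2 (size t); last first.
  (* The length of a closed word is a multiple of 4, so a remainder of at most two letters is
     empty. *)
  have t0 : t = [::].
    by apply: size0nil; have := closed_word_size _ _ Ct; rewrite [size _]/=; move: t2; lia.
  move: Ct U; rewrite t0 => Ct U.
  case/reducibleP: Ct => // -[i [a' [b' [c' [d' [t' [si E /andP[ne' bl] rt]]]]]]].
  (* A window starting at [b] or at [d] would need a link that the block excludes; only the starts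
     [a] and [c] remain. *)
  case: i si E => [|[|[|[|i]]]] //= _; rewrite /rot /= => -[] *; subst.
  - by left; case/and4P: bl => /= -> /negbTE-> /negbTE-> /negbTE->.
  - by move: ne'; rewrite /nested /= !(nested_inj _ _ _ _ _ U ne).
  - right; case/and4P: bl => /= -> /negbTE-> /negbTE-> /negbTE->; split=> //.
    apply: reducible_base; rewrite /unmarked_ring /= andbT.
    by move/andP: ne => []; rewrite (linkedC _ d a) => -> ->; rewrite orbT.
  - by move: ne'; rewrite /nested /= !(nested_inj _ _ _ _ _ U ne).
case: (reducible_nested_inv p _ (a, w1) (b, w2) (c, w3) (d, w4) t (@nilp_rot _) _ ne t2 Ct) => //.
  move=> [/andP[_ /and4P[/= -> /negbTE-> /negbTE-> /negbTE->]] rt].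
  by left.
move=> [A [x [y [z [w [B [tE op rt]]]]]]]; subst t.
move: U; rewrite map_cat => /(uniq_skip _ [:: a, b, c, d & map fst A] [:: _;_;_;_]) U.
have [|||[-> r]|[-> r]] := IH (A ++ B); rewrite ?map_cat //.
- by move: tn; rewrite !size_cat /=; lia.
- by left; split=> //; apply: (reducible_insert _ _ (@nilp_rot _)).
- right; split=> //; rewrite -!cat_cons.
  by apply: (reducible_insert _ _ (unmarked_ring_rot p)).
Qed.

(** The induction is the one for closed words, but the exceptional case now ends at an unmarked ring
    that contains the block. This ring has four points, and marking [c] makes it removable. *)
Lemma ringed_word_nested_inv p (a b c d : nat) w1 w2 w3 w4 (t : seq (nat * bool)) :
  uniq [:: a, b, c, d & map fst t] -> nested p a b c d ->
  ringed_word p [:: (a, w1), (b, w2), (c, w3), (d, w4) & t] ->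
  [:: w1; w2; w3; w4] = [:: true; false; false; false] /\ ringed_word p t \/
  [:: w1; w2; w3; w4] = [:: false; false; false; false] /\
    closed_word p [:: (a, false), (b, false), (c, true), (d, false) & t].
Proof.
move=> + ne; have [n] := ubnP (size t); elim: n t => // n IH t tn U Rt.
have base : unmarked_ring p [:: (a, w1), (b, w2), (c, w3), (d, w4) & t] ->
    [:: w1; w2; w3; w4] = [:: false; false; false; false] /\
    closed_word p [:: (a, false), (b, false), (c, true), (d, false) & t].
  move=> /andP[ri un]; have := ring_size _ _ ri; rewrite /= size_map => -[[]|[]] st.
    rewrite (size0nil st); move: un => /and5P[/= /negbTE-> /negbTE-> /negbTE-> /negbTE-> _].
    split=> //; apply:
      (@reducible_step _ _ _ 2 _ (c, true) (d, false) (a, false) (b, false) [::]) => //.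
    by rewrite /opened /= andbT /nested (linkedC p c) (linkedC p d) andbC.
  (* A ring on six points is excluded: containing the edge from [b] to [c], it would link [d] to
     [x], while the block links [d] to [a]. *)
  move: ri U; case: t st {IH tn Rt un} => [|x [|y []]] //= _.
  move=> + U; have U4 : uniq [:: a; b; c; d].
    by move: U; apply: (@subseq_uniq _ _ ([:: a; b; c; d] ++ _)); apply: prefix_subseq.
  rewrite !(nested_inj _ _ _ _ _ U4 ne) /= => /and3P[_ /andP[/eqP dx _] _].
  by case/andP: ne U => /andP[_]; rewrite dx => /eqP-> _; rewrite /= !inE eqxx !orbT.
have [t2|t2] := ltnP 2 (size t); last first.
  case/reducibleP: Rt => [/base|[i [a' [b' [c' [d' [t' [si E /andP[ne' bl] rt]]]]]]]].
    by right.
  (* A removal would leave at most two letters, too few for a ring. *)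
  have := ringed_word_size _ _ rt; have := size_rot i [:: (a, w1), (b, w2), (c, w3), (d, w4) & t].
  by rewrite E /=; move: t2; lia.
case: (reducible_nested_inv p _ (a, w1) (b, w2) (c, w3) (d, w4) t
        (unmarked_ring_rot p) _ ne t2 Rt) => //.
- by move/base; right.
- move=> [/andP[_ /and4P[/= -> /negbTE-> /negbTE-> /negbTE->]] rt].
  by left.
move=> [A [x [y [z [w [B [tE op rt]]]]]]]; subst t.
move: U; rewrite map_cat => /(uniq_skip _ [:: a, b, c, d & map fst A] [:: _;_;_;_]) U.
have [|||[-> r]|[-> r]] := IH (A ++ B); rewrite ?map_cat //.
- by move: tn; rewrite !size_cat /=; lia.
- by left; split=> //; apply: (reducible_insert _ _ (unmarked_ring_rot p)).
- right; split=> //; rewrite -!cat_cons.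
  by apply: (reducible_insert _ _ (@nilp_rot _)).
Qed.

Arguments closed_word_nested_inv {p a b c d w1 w2 w3 w4 t}.
Arguments ringed_word_nested_inv {p a b c d w1 w2 w3 w4 t}.

(** * Words compatible with a matching *)

(** Words are listed explicitly so that a count over them splits letter by letter. *)
Fixpoint words (n : nat) : seq (seq bool) :=
  if n is m.+1 then map (cons true) (words m) ++ map (cons false) (words m)
  else [:: [::]].

Lemma count_words_cons (P : pred (seq bool)) n :
  count P (words n.+1) =
  count (fun u => P (true :: u)) (words n) + count (fun u => P (false :: u)) (words n).
Proof. by rewrite /= count_cat !count_map. Qed.

Lemma mem_words n u : (u \in words n) = (size u == n).
Proof.
have inj b : injective (@cons bool b) by move=> ? ? [].
elim: n u => [|n IH] [|b u] //=; rewrite mem_cat.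
  by apply/negP => /orP[] /mapP[].
rewrite eqSS -IH; case: b; rewrite mem_map //.
- by rewrite (_ : (_ \in map (cons false) _) = false) ?orbF //; apply/negP => /mapP[].
- by rewrite (_ : (_ \in map (cons true) _) = false) //; apply/negP => /mapP[].
Qed.

Lemma words_uniq n : uniq (words n).
Proof.
elim: n => //= n IH; rewrite cat_uniq !map_inj_uniq ?IH //= ?andbT; try by move=> ? ? [].
by apply/hasPn => _ /mapP[u _ ->]; apply/negP => /mapP[].
Qed.

Lemma count_words_rot (P : pred (seq bool)) i n :
  count (fun u => P (rot i u)) (words n) = count P (words n).
Proof.
rewrite -(count_map (rot i) P); apply/permP/uniq_perm.
- by rewrite map_inj_uniq ?words_uniq //; apply: rot_inj.
- exact: words_uniq.
move=> u; rewrite -{1}(rotrK i u) mem_map ?mem_words ?size_rotr //.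
exact: rot_inj.
Qed.

Lemma count_words_bin n l : count (fun u => count id u == l) (words n) = 'C(n, l).
Proof.
elim: n l => [|n IH] [|l] //; rewrite count_words_cons.
  by rewrite bin0 -[RHS](bin0 n) -IH (@eq_count _ _ pred0) ?count_pred0.
by rewrite binS -!IH addnC.
Qed.

Definition closed_words p (c : seq nat) :=
  count (fun u => closed_word p (zip c u)) (words (size c)).
Definition ringed_words p (c : seq nat) :=
  count (fun u => ringed_word p (zip c u)) (words (size c)).

Lemma zip_rot (S T : Type) i (s : seq S) (t : seq T) :
  size s = size t -> zip (rot i s) (rot i t) = rot i (zip s t).
Proof.
move=> st; rewrite -[RHS]zip_unzip /unzip1 /unzip2 !map_rot.
by rewrite -/(unzip1 _) -/(unzip2 _) unzip1_zip ?unzip2_zip ?st.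
Qed.

Lemma closed_words_rot p i c : closed_words p (rot i c) = closed_words p c.
Proof.
rewrite /closed_words size_rot -(count_words_rot _ i); apply: eq_in_count => u.
rewrite mem_words => /eqP su; rewrite zip_rot //.
exact: (reducible_rot _ _ (@nilp_rot _)).
Qed.

Lemma ringed_words_rot p i c : ringed_words p (rot i c) = ringed_words p c.
Proof.
rewrite /ringed_words size_rot -(count_words_rot _ i); apply: eq_in_count => u.
rewrite mem_words => /eqP su; rewrite zip_rot //.
exact: (reducible_rot _ _ (unmarked_ring_rot p)).
Qed.

Lemma closed_word_dvd4 p c u : size u = size c -> closed_word p (zip c u) -> 4 %| size c.
Proof. by move=> su /closed_word_size; rewrite size2_zip ?su. Qed.

(** The number [x] counts the exceptional words, and is the same on both sides because erasing the
    mark at [c] exchanges ddUd and dddd. Hence removing a block does not change the difference of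
    the two counts. *)
Lemma closed_ringed_words_nested p a b c d t :
  uniq [:: a, b, c, d & t] -> nested p a b c d ->
  exists x, closed_words p [:: a, b, c, d & t] = closed_words p t + x /\
            ringed_words p [:: a, b, c, d & t] = ringed_words p t + x.
Proof.
move=> U ne.
have Uz v : v \in words (size t) -> uniq [:: a, b, c, d & map fst (zip t v)].
  by rewrite mem_words -/(unzip1 _) => /eqP sv; rewrite unzip1_zip ?sv.
exists (count (fun v => closed_word p [:: (a, false), (b, false), (c, true), (d, false) & zip t v])
              (words (size t))).
have CR v : v \in words (size t) ->
    closed_word p [:: (a, false), (b, false), (c, true), (d, false) & zip t v] =
    ringed_word p [:: (a, false), (b, false), (c, false), (d, false) & zip t v].
  move=> /Uz Uv; apply/idP/idP.
    by case/(closed_word_nested_inv Uv ne) => -[].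
  by case/(ringed_word_nested_inv Uv ne) => -[].
set x := count _ _.
split.
  (* Of the sixteen readings of the block, only Uddd and ddUd contribute. *)
  have E w1 w2 w3 w4 : count (fun v =>
      closed_word p [:: (a, w1), (b, w2), (c, w3), (d, w4) & zip t v]) (words (size t)) =
      ([:: w1; w2; w3; w4] == [:: true; false; false; false]) * closed_words p t +
      ([:: w1; w2; w3; w4] == [:: false; false; true; false]) * x.
    case: eqP => [[-> -> -> ->]|N1].
      rewrite mul1n addn0; apply: eq_in_count => v /Uz Uv; apply/idP/idP.
        by case/(closed_word_nested_inv Uv ne) => -[].
      by apply: reducible_cons; rewrite /opened ne.
    case: eqP => [[-> -> -> ->]|N2]; first by rewrite mul1n.
    rewrite (@eq_in_count _ _ pred0) ?count_pred0 // => v /Uz Uv; apply/negP.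
    by case/(closed_word_nested_inv Uv ne) => -[].
  by rewrite {1}/closed_words [size _]/= !count_words_cons !E /=; lia.
have E w1 w2 w3 w4 : count (fun v =>
    ringed_word p [:: (a, w1), (b, w2), (c, w3), (d, w4) & zip t v]) (words (size t)) =
    ([:: w1; w2; w3; w4] == [:: true; false; false; false]) * ringed_words p t +
    ([:: w1; w2; w3; w4] == [:: false; false; false; false]) * x.
  case: eqP => [[-> -> -> ->]|N1].
    rewrite mul1n addn0; apply: eq_in_count => v /Uz Uv; apply/idP/idP.
      by case/(ringed_word_nested_inv Uv ne) => -[].
    by apply: reducible_cons; rewrite /opened ne.
  case: eqP => [[-> -> -> ->]|N2].
    by rewrite mul1n; apply: eq_in_count => v /CR.
  rewrite (@eq_in_count _ _ pred0) ?count_pred0 // => v /Uz Uv; apply/negP.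
  by case/(ringed_word_nested_inv Uv ne) => -[].
by rewrite {1}/ringed_words [size _]/= !count_words_cons !E /=; lia.
Qed.

Arguments closed_ringed_words_nested {p a b c d t}.

Lemma closed_words_ndvd4 p c : ~~ (4 %| size c) -> closed_words p c = 0.
Proof.
move=> c4; rewrite /closed_words (@eq_in_count _ _ pred0) ?count_pred0 // => u.
by rewrite mem_words => /eqP su; apply/negP => /closed_word_dvd4; rewrite (negbTE c4) => /(_ su).
Qed.

(** Removing a block from six letters leaves two, which carry no ring, so only the word without
    marks is compatible. *)
Lemma ringed_words_ring6 p c : ring p c -> size c = 6 -> ringed_words p c = 1.
Proof.
move=> ri c6; rewrite /ringed_words c6; transitivity (count (all negb) (words 6)); last by [].
apply: eq_in_count => u; rewrite mem_words => /eqP su.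
have un : unmarked_ring p (zip c u) = all negb u.
  rewrite /unmarked_ring -/(unzip1 _) unzip1_zip ?c6 ?su // ri /=.
  by rewrite -[in RHS](@unzip2_zip _ _ c u) ?c6 ?su // all_map.
rewrite -un; apply/idP/idP => [|bs]; last exact: reducible_base.
move=> /reducibleP[] // [i [x [y [z [w [t [_ E _ /ringed_word_size]]]]]]].
by have := size_rot i (zip c u); rewrite E size2_zip su ?c6 //= => -[->].
Qed.

(** The difference of the counts is invariant under removals and is read off at the end: the empty
    word is closed, and a ring on six points has one ringed word and no closed one. The additive
    form avoids truncated subtraction. *)
Lemma L_reducible_count p c : L_reducible p c -> uniq c ->
  ringed_words p c + (4 %| size c) = closed_words p c + ~~ (4 %| size c).
Proof.
have [n] := ubnP (size c); elim: n c => // n IH c cn.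
have step i a b d e t : rot i c = [:: a, b, d, e & t] -> nested p a b d e ->
    ringed_words p t + (4 %| size t) = closed_words p t + ~~ (4 %| size t) -> uniq c ->
    ringed_words p c + (4 %| size c) = closed_words p c + ~~ (4 %| size c).
  move=> E ne Et; rewrite -(rot_uniq i) -(ringed_words_rot _ i) -(closed_words_rot _ i).
  rewrite -(size_rot i) E => U.
  have [x [-> ->]] := closed_ringed_words_nested U ne.
  rewrite /= (_ : 4 %| (size t).+4 = (4 %| size t)); last by lia.
  by rewrite addnAC Et addnAC.
move=> /reducibleP[ri|[i [a [b [d [e [t [_ E ne Lt]]]]]]]] U; last first.
  apply: (step i a b d e t) => //; apply: IH => //.
    by have := size_rot i c; rewrite E /=; move: cn; lia.
  by move: U; rewrite -(rot_uniq i) E => /and5P[].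
case: (ring_size _ _ ri) => c4; last first.
  by rewrite c4 /= (ringed_words_ring6 _ _ ri c4) closed_words_ndvd4 ?c4.
(* A ring on four points is itself a block, read from its second or its first point, and reduces to
   the empty word. *)
case: c ri c4 U step {IH cn} => [|a [|b [|d [|e []]]]] //= /orP[] /andP[l1 l2] _ U step.
- by apply: (step 1 b d e a [::]) => //; rewrite /nested linkedC l1.
- by apply: (step 0 a b d e [::]) => //; rewrite /nested linkedC l2.
Qed.

(** * Matchings compatible with a word *)

Lemma count_rot T (P : pred T) i s : count P (rot i s) = count P s.
Proof. by rewrite count_cat addnC -count_cat cat_take_drop. Qed.

(** If no mark were followed by three unmarked letters, each mark would own at most three letters,
    and the length would not exceed three times the number of marks. *)
Lemma exists_opening (s : seq (nat * bool)) :
  0 < count snd s -> 3 * count snd s < size s ->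
  exists i a b c d t,
    rot i s = [:: (a, true), (b, false), (c, false), (d, false) & t].
Proof.
move=> /[dup] c0; rewrite -has_count => /hasP[[a []] // /rot_to[i r E] _].
suff lin (x : nat * bool) r' : x.2 -> 3 * count snd (x :: r') < size (x :: r') ->
    exists s1 a b c d s2,
    x :: r' = s1 ++ [:: (a, true), (b, false), (c, false), (d, false) & s2].
  move=> c3; have [||s1 [a1 [b [c [d [s2 E2]]]]]] := lin (a, true) r => //.
    by rewrite -E size_rot count_rot.
  have rE : rot (size s1) (rot i s) =
      [:: (a1, true), (b, false), (c, false), (d, false) & s2 ++ s1].
    by rewrite E E2 rot_size_cat.
  case: (leqP i (size s)) => si; last first.
    rewrite (rot_oversize (ltnW si)) in rE.
    by exists (size s1), a1, b, c, d, (s2 ++ s1).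
  rewrite rot_add_mod // in rE; first by eexists; exists a1, b, c, d, (s2 ++ s1); exact: rE.
  by rewrite -(size_rot i s) E E2 size_cat leq_addr.
have [n] := ubnP (size r'); elim: n x r' => // n IH [x []] // r' rn _.
(* Skipping to the next mark [y] drops one mark and at most three letters, which preserves the
   strict inequality. *)
have rec y s1 s2 : r' = s1 ++ y :: s2 -> y.2 -> size s1 <= 2 -> count snd s1 = 0 ->
    3 * count snd ((x, true) :: r') < size ((x, true) :: r') ->
    exists s1 a b c d s2, (x, true) :: r' =
      s1 ++ [:: (a, true), (b, false), (c, false), (d, false) & s2].
  move=> rE y2 s2' c1; rewrite rE /= count_cat size_cat /= c1 y2 => c3.
  have [||s3 [a1 [b [c [d [s4 ->]]]]]] := IH y s2 _ y2.
  - by move: rn; rewrite rE size_cat /=; lia.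
  - by rewrite /= y2; lia.
  by exists ((x, true) :: s1 ++ s3), a1, b, c, d, s4; rewrite /= -catA.
case: r' rn rec => [|[y []] r1] rn rec; first by [].
  by apply: (rec _ [::] r1).
case: r1 rn rec => [|[z []] r1] rn rec; first by [].
  by apply: (rec _ [:: (y, false)] r1).
case: r1 rn rec => [|[w []] r1] rn rec; first by [].
  by apply: (rec _ [:: (y, false); (z, false)] r1).
by move=> _; exists [::], x, y, z, w, r1.
Qed.

(** Exactly [N] partner functions are compatible with [s], up to agreement on its labels. An
    explicit enumeration replaces a cardinal because the functions are defined on all of [nat]. *)
Definition partner_count (base : (nat -> nat) -> pred (seq (nat * bool))) N
    (s : seq (nat * bool)) : Prop :=
  exists P : 'I_N -> nat -> nat,
  [/\ forall i, reducible (opened (P i)) (base (P i)) s,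
      forall i j, {in map fst s, P i =1 P j} -> i = j &
      forall p, reducible (opened p) (base p) s ->
        exists i, {in map fst s, p =1 P i}].

Section PartnerCount.
Context (base : (nat -> nat) -> pred (seq (nat * bool))) (N : nat).
Context (base_rot : forall p i s, base p (rot i s) = base p s)
  (base_unmarked : forall p s, base p s -> unmarked s)
  (base_ext : forall p q s, {in map fst s, p =1 q} -> base p s = base q s).

Lemma reducible_opened_ext p q s : {in map fst s, p =1 q} ->
  reducible (opened p) (base p) s = reducible (opened q) (base q) s.
Proof.
move=> pq; rewrite -{1}[s]map_id.
apply: (@reducible_map _ _ _ (fun x => x.1 \in map fst s)).
- by move=> a b c d Pa Pb Pc Pd; rewrite /opened /nested /linked !pq.
- move=> r /allP sr; rewrite map_id; apply: base_ext => _ /mapP[x xr ->].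
  by apply: pq; apply: sr.
- by apply/allP => x xs; apply: map_f.
Qed.

Lemma partner_count_rot i s :
  partner_count base N (rot i s) -> partner_count base N s.
Proof.
have rs : map fst (rot i s) =i map fst s by move=> x; rewrite map_rot mem_rot.
move=> [P [P1 P2 P3]]; exists P; split=> [j|j k PP|p].
- by rewrite -(reducible_rot _ _ (base_rot _) i).
- by apply: P2 => x; rewrite rs; apply: PP.
- rewrite -(reducible_rot _ _ (base_rot _) i) => /P3[j jP]; exists j => x.
  by rewrite -rs; apply: jP.
Qed.

(** The leading Uddd is a block of every compatible function, so restriction to [t] loses nothing;
    [Q] is the inverse extension, by the edges from [a] to [d] and from [b] to [c]. *)
Lemma partner_count_cons (a b c d : nat) (t : seq (nat * bool)) :
  uniq [:: a, b, c, d & map fst t] -> partner_count base N t ->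
  partner_count base N [:: (a, true), (b, false), (c, false), (d, false) & t].
Proof.
move=> U [P [P1 P2 P3]].
pose Q i x := if x == a then d else if x == b then c else if x == c then b
              else if x == d then a else P i x.
move: U; rewrite -[[:: a, b, c, d & _]]/([:: a; b; c; d] ++ _) cat_uniq.
move=> /and3P[U /hasPn Ut _].
have tQ i : {in map fst t, Q i =1 P i}.
  move=> x /Ut; rewrite !inE !negb_or /Q => /and4P[/negbTE-> /negbTE-> /negbTE->].
  by move/negbTE->.
move: U; rewrite /= !inE !negb_or -!andbA.
move=> /and5P[ab ac ad bc /andP[bd /andP[cd _]]].
have Qa i : Q i a = d by rewrite /Q eqxx.
have Qb i : Q i b = c by rewrite /Q eq_sym (negbTE ab) eqxx.
have Qc i : Q i c = b by rewrite /Q !(eq_sym c) (negbTE ac) (negbTE bc) eqxx.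
have Qd i : Q i d = a.
  by rewrite /Q !(eq_sym d) (negbTE ad) (negbTE bd) (negbTE cd) eqxx.
exists Q; split=> [i|i j QQ|p].
- apply: reducible_cons; last by rewrite (reducible_opened_ext _ (P i)) //; apply: P1.
  by rewrite /opened /nested /linked /= Qa Qb Qc Qd !eqxx.
- apply: P2 => x xt; rewrite -!tQ //; apply: QQ.
  by rewrite /= !inE xt !orbT.
- move=> /(reducible_opened_inv _ _ _ _ _ _ _ (base_rot p) (base_unmarked p)).
  move=> [/andP[/andP[/eqP pa /eqP pd] /andP[/eqP pb /eqP pc]] /P3[i pP]].
  exists i => x; rewrite /= !inE => /or4P[/eqP->|/eqP->|/eqP->|/orP[/eqP->|xt]].
  + by rewrite Qa.
  + by rewrite Qb.
  + by rewrite Qc.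
  + by rewrite Qd.
  + by rewrite tQ // pP.
Qed.

(** As long as marks remain, some Uddd exists and its removal is forced, so the count is that of the
    unmarked letters left at the end. *)
Lemma partner_count_marked (s : seq (nat * bool)) :
  (forall r : seq (nat * bool), uniq (map fst r) -> unmarked r ->
     size r + 4 * count snd s = size s -> partner_count base N r) ->
  uniq (map fst s) -> 4 * count snd s <= size s -> partner_count base N s.
Proof.
have [n] := ubnP (size s); elim: n s => // n IH s sn base_count U c4.
have [c0|c0] := posnP (count snd s).
  apply: base_count => //; last by rewrite c0 muln0 addn0.
  by rewrite /unmarked all_predC has_count c0.
have [|i [a [b [c [d [t E]]]]]] := exists_opening s c0; first by move: c0 c4; lia.
apply: (partner_count_rot i); move: U; rewrite -(rot_uniq i) -map_rot E => U.
have := size_rot i s; have := count_rot _ (@snd nat bool) i s; rewrite E /= => cE sE.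
apply: partner_count_cons => //; apply: IH.
- by move: sn; lia.
- by move=> r Ur un rt; apply: base_count => //; move: rt; lia.
- by move: U => /= /and5P[].
- by move: c4; lia.
Qed.

End PartnerCount.

Lemma ring_ext p q s : {in s, p =1 q} -> ring p s = ring q s.
Proof.
case: s => [|a [|b [|c [|d [|e [|f [|g s]]]]]]] //= pq;
  by rewrite /linked !pq // !inE eqxx ?orbT.
Qed.

Lemma partner_count_nil (s : seq (nat * bool)) : uniq (map fst s) -> 4 * count snd s = size s ->
  partner_count (fun _ => @nilp _) 1 s.
Proof.
move=> U c4; apply: partner_count_marked => //.
- by move=> _; apply: nilp_rot.
- by move=> _ [].
- move=> r _ _; rewrite c4 => r0; have /size0nil-> : size r = 0 by lia.
  (* On no labels all functions agree, so the constant 0 represents the only one. *)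
  by exists (fun _ _ => 0); split=> // [i j|p] _; [rewrite !ord1 | exists ord0].
- by rewrite c4.
Qed.

Lemma ringed_word_unmarked p s : unmarked s -> ringed_word p s = ring p (map fst s).
Proof.
move=> un; apply/idP/idP => [/reducibleP[/andP[]//|]|ri]; last first.
  by apply: reducible_base; rewrite /unmarked_ring ri.
move=> [i [a [b [c [d [t [_ E /andP[_ /andP[a2 _]] _]]]]]]].
by move: un; rewrite -(unmarked_rot i) E /= a2.
Qed.

Lemma partner_count_ring (s : seq (nat * bool)) : uniq (map fst s) ->
  4 * count snd s + 4 = size s \/ 4 * count snd s + 6 = size s ->
  partner_count unmarked_ring 2 s.
Proof.
move=> U c4; apply: partner_count_marked => //.
- by move=> p i r; apply: unmarked_ring_rot.
- by move=> p r /andP[].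
- by move=> p q r pq; rewrite /unmarked_ring (ring_ext p q).
- move=> r Ur un sr.
  suff [p0 [p1 [r0 r1 [x xr px] rs]]] : exists p0 p1, [/\ ring p0 (map fst r),
      ring p1 (map fst r), exists2 x, x \in map fst r & p0 x <> p1 x &
      forall p, ring p (map fst r) ->
        {in map fst r, p =1 p0} \/ {in map fst r, p =1 p1}].
    exists (fun i => if i == ord0 then p0 else p1); split.
    - by move=> i; rewrite ringed_word_unmarked //; case: ifP.
    - move=> i j; case: eqP => [->|/eqP i0]; case: eqP => [->|/eqP j0] // H.
      + by case: px; apply: H.
      + by case: px; rewrite H.
      + by apply: val_inj; case: i j i0 j0 {H} => [[|[|i]] ?] [[|[|j]] ?].
    - move=> p; rewrite ringed_word_unmarked // => /rs[H|H]; first by exists ord0.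
      by exists (lift ord0 ord0).
  have {sr un c4} : size (map fst r) = 4 \/ size (map fst r) = 6.
    by rewrite size_map; lia.
  move: (map fst r) Ur => {U}{}r U.
  have pE r' i : i < size r -> nth 0 r' (index (nth 0 r i) r) = nth 0 r' i.
    by move=> si; rewrite index_uniq.
  case: r U pE => [|a [|b [|c [|d [|e [|f [|g r]]]]]]] U pE [] // _.
  (* Each ring is given as a table of partners aligned with the list of labels; the two tables
     differ at [a]. *)
  + exists (fun x => nth 0 [:: b; a; d; c] (index x [:: a; b; c; d])).
    exists (fun x => nth 0 [:: d; c; b; a] (index x [:: a; b; c; d])).
    have {}pE r' := (pE r' 0 isT, pE r' 1 isT, pE r' 2 isT, pE r' 3 isT).
    rewrite /= in pE; split.
    - by rewrite /ring /linked !pE /= !eqxx.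
    - by rewrite /ring /linked !pE /= !eqxx orbT.
    - exists a; rewrite ?inE ?eqxx // !pE /= => bd.
      by move: U; rewrite bd /= !inE eqxx !orbT andbF.
    move=> p /orP[] /andP[/andP[/eqP pa /eqP pb] /andP[/eqP pc /eqP pd]]; [left|right];
      by move=> x; rewrite !inE => /or4P[] /eqP->; rewrite !pE /= ?pa ?pb ?pc ?pd.
  + exists (fun x => nth 0 [:: b; a; d; c; f; e] (index x [:: a; b; c; d; e; f])).
    exists (fun x => nth 0 [:: f; c; b; e; d; a] (index x [:: a; b; c; d; e; f])).
    have {}pE r' := (pE r' 0 isT, pE r' 1 isT, pE r' 2 isT, pE r' 3 isT,
                     pE r' 4 isT, pE r' 5 isT).
    rewrite /= in pE; split.
    - by rewrite /ring /linked !pE /= !eqxx.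
    - by rewrite /ring /linked !pE /= !eqxx orbT.
    - exists a; rewrite ?inE ?eqxx // !pE /= => bd.
      by move: U; rewrite bd /= !inE eqxx !orbT andbF.
    move=> p /orP[] /and3P[/andP[/eqP pa /eqP pb] /andP[/eqP pc /eqP pd]
      /andP[/eqP pe /eqP pf]]; [left|right];
      by move=> x; rewrite !inE => /or4P[/eqP->|/eqP->|/eqP->|/or3P[] /eqP->];
        rewrite !pE /= ?pa ?pb ?pc ?pd ?pe ?pf.
- by move: c4; lia.
Qed.

(** * Planarity *)

Lemma ring_nested p a b c d : nested p a b c d -> ring p [:: a; b; c; d].
Proof. by move=> /andP[ad bc] /=; rewrite bc (linkedC p d) ad orbT. Qed.

(** Forgetting the marks turns a removal of Uddd into a removal of a block; when nothing is left,
    the block itself is a ring on four points. *)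
Lemma L_reducible_map_rot p i (s : seq (nat * bool)) x y z w t :
  rot i s = [:: x, y, z, w & t] -> opened p x y z w ->
  nilp t || L_reducible p (map fst t) -> L_reducible p (map fst s).
Proof.
move=> E /andP[ne _] Lt; rewrite -(reducible_rot _ _ (ring_rot p) i) -map_rot E /=.
case/orP: Lt => [/nilP-> /=|]; last exact: reducible_cons.
by apply: reducible_base; apply: ring_nested.
Qed.

Lemma closed_word_L p s : closed_word p s -> nilp s || L_reducible p (map fst s).
Proof.
have [n] := ubnP (size s); elim: n s => // n IH s sn.
move=> /reducibleP[->//|[i [a [b [c [d [t [_ E bl rt]]]]]]]].
rewrite (L_reducible_map_rot _ _ _ _ _ _ _ _ E bl) ?orbT // IH //.
by have := size_rot i s; rewrite E /=; move: sn; lia.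
Qed.

Lemma ringed_word_L_reducible p s : ringed_word p s -> L_reducible p (map fst s).
Proof.
have [n] := ubnP (size s); elim: n s => // n IH s sn.
move=> /reducibleP[/andP[ri _]|[i [a [b [c [d [t [_ E bl rt]]]]]]]].
  exact: reducible_base.
rewrite (L_reducible_map_rot _ _ _ _ _ _ _ _ E bl) // IH ?orbT //.
by have := size_rot i s; rewrite E /=; move: sn; lia.
Qed.

Definition fpf_involution (p : nat -> nat) (s : seq nat) :=
  {in s, forall x, [/\ p x \in s, p (p x) = x & p x != x]}.

Lemma fpf_involution_cat p s t :
  fpf_involution p s -> fpf_involution p t -> fpf_involution p (s ++ t).
Proof.
move=> ps pt x; rewrite !mem_cat => /orP[/ps|/pt] [-> -> ->];
  by rewrite ?orbT.
Qed.

Lemma fpf_involution_mem p s t : s =i t -> fpf_involution p s -> fpf_involution p t.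
Proof. by move=> st ps x; rewrite -!st => /ps. Qed.

Lemma fpf_involution2 p x y : x != y -> linked p x y -> fpf_involution p [:: x; y].
Proof.
move=> xy /andP[/eqP px /eqP py] z; rewrite !inE => /orP[] /eqP->;
  by rewrite ?px ?py ?px eqxx ?orbT // eq_sym.
Qed.

(** The forbidden pattern is a pair of chords whose ends interleave along [s]. *)
Definition planar (p : nat -> nat) (s : seq nat) :=
  forall x y, ~~ subseq [:: x; y; p x; p y] s.

Lemma subseq2_cat (T : eqType) (u v : T) s t :
  subseq [:: u; v] (s ++ t) -> u \in s \/ v \in t.
Proof.
elim: s => [|z s IH] /=.
  by move=> /mem_subseq/(_ v); rewrite !inE eqxx orbT => /(_ isT); right.
by case: eqP => [->|_]; rewrite inE ?eqxx; [left | move=> /IH[->|vt]; [left; rewrite orbT | right]].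
Qed.

Lemma planar_cat p s t : uniq (s ++ t) -> fpf_involution p s -> fpf_involution p t ->
  planar p s -> planar p t -> planar p (s ++ t).
Proof.
rewrite cat_uniq => /and3P[_ /hasPn st _] ps pt ns nt x y; apply/negP => sub.
have ts z : z \in s -> z \notin t by move=> zs; apply: contraL zs; apply: st.
have sub2 u v : subseq [:: u; v] [:: x; y; p x; p y] -> u \in s \/ v \in t.
  by move=> uv; apply: subseq2_cat (subseq_trans uv sub).
have memq z : z \in [:: x; y; p x; p y] -> (z \in s) = ~~ (z \in t).
  move=> /(mem_subseq sub); rewrite mem_cat => /orP[zs|zt].
    by rewrite zs (ts _ zs).
  by rewrite zt (negbTE (st _ zt)).
(* Filtering by [s] or by [t] confines a crossing with both chords on one side to that side. *)
have fs : filter (mem s) (s ++ t) = s.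
  rewrite filter_cat (eq_in_filter (a2 := predT)) ?filter_predT; last by move=> z /= ->.
  by rewrite (eq_in_filter (a2 := pred0)) ?filter_pred0 ?cats0 // => z /= /st/negbTE.
have ft : filter (mem t) (s ++ t) = t.
  rewrite filter_cat (eq_in_filter (a2 := pred0)) ?filter_pred0; last by move=> z /= /ts/negbTE.
  by rewrite (eq_in_filter (a2 := predT)) ?filter_predT // => z /= ->.
have memx : x \in [:: x; y; p x; p y] by rewrite !inE eqxx.
have memy : y \in [:: x; y; p x; p y] by rewrite !inE eqxx orbT.
have [xs|] := boolP (x \in s); have [ys|] := boolP (y \in s).
- have [[pxs _ _] [pys _ _]] := (ps x xs, ps y ys).
  have := ns x y; rewrite -{1}fs subseq_filter sub andbT /=.
  by rewrite xs ys pxs pys.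
(* In the mixed cases a point of [t] would precede a point of [s] in the concatenation. *)
- move=> yt; have [pxs _ _] := ps x xs.
  have [|ys|pxt] := sub2 y (p x); last by move: (ts _ pxs); rewrite pxt.
    exact: subseq_trans (prefix_subseq [:: y; p x] [:: p y]) (subseq_cons _ x).
  by rewrite ys in yt.
- move=> xt; have [|xs|yt] := sub2 x y; last by move: (ts _ ys); rewrite yt.
    exact: (prefix_subseq [:: x; y] [:: p x; p y]).
  by rewrite xs in xt.
rewrite memq // negbK => yt; rewrite memq // negbK => xt.
have [[pxs _ _] [pys _ _]] := (pt x xt, pt y yt).
have := nt x y; rewrite -{1}ft subseq_filter sub andbT /=.
by rewrite xt yt pxs pys.
Qed.

Lemma subseq_rcons_rcons (T : eqType) (q r : seq T) u v :
  subseq (rcons q u) (rcons r v) -> subseq (rcons q u) r || (u == v) && subseq q r.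
Proof.
rewrite -(subseq_rev (rcons q u)) -(subseq_rev _ r) -(subseq_rev q) !rev_rcons /=.
by case: eqP => _ ->; rewrite ?orbT.
Qed.

Lemma planar_rot p i s : fpf_involution p s -> planar p s -> planar p (rot i s).
Proof.
elim: i s => [|i IH] s; first by rewrite rot0.
have [si|si] := ltnP i (size s); last by rewrite rot_oversize // ltnW.
move=> ps ns; rewrite rotS //.
have psi : fpf_involution p (rot i s).
  by apply: fpf_involution_mem ps => x; rewrite mem_rot.
move: (rot i s) psi (IH s ps ns) => [|x r] // pr nr y z.
rewrite /rot /= take0 drop0 cats1; apply/negP => sub.
have [sub3|/andP[/eqP zx sub3]] := orP (subseq_rcons_rcons _ [:: y; z; p y] _ _ _ sub).
  by have := nr y z; rewrite (subseq_trans sub3 (subseq_cons r x)).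
have [|_ pz _] := pr z.
  by rewrite inE (mem_subseq sub3) ?orbT // !inE eqxx orbT.
(* The moved point [x] is [p z]; put back in front, it gives a crossing of the same chords with the
   first one read from its other end. *)
by have := nr (p z) y; rewrite pz {1}zx /= eqxx sub3.
Qed.

(** * Relabelling *)

Lemma planar_cons_pair p x y s : x != y -> linked p x y -> uniq [:: x, y & s] ->
  fpf_involution p s /\ planar p s ->
  fpf_involution p [:: x, y & s] /\ planar p [:: x, y & s].
Proof.
move=> xy l U [ps ns]; have pxy := fpf_involution2 _ _ _ xy l.
split; first by apply: (@fpf_involution_cat p [:: x; y]).
by apply: (@planar_cat p [:: x; y]) => // u v; apply/negP => /size_subseq.
Qed.

(** Rings and blocks are assembled from contiguous non-crossing pieces, so reducibility alone
    implies the matching conditions. *)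
Lemma L_reducible_planar p (c : seq nat) : uniq c -> L_reducible p c ->
  fpf_involution p c /\ planar p c.
Proof.
have [n] := ubnP (size c); elim: n c => // n IH c cn U.
have unrot i r : fpf_involution p (rot i r) /\ planar p (rot i r) ->
    fpf_involution p r /\ planar p r.
  move=> [pr nr]; split; first by apply: fpf_involution_mem pr => x; rewrite mem_rot.
  by rewrite -(rotK i r); apply: planar_rot.
have nilQ : fpf_involution p [::] /\ planar p [::] by [].
have add2 x y s : linked p x y -> uniq [:: x, y & s] ->
    (uniq s -> fpf_involution p s /\ planar p s) ->
    fpf_involution p [:: x, y & s] /\ planar p [:: x, y & s].
  move=> l U2 H; have := U2; rewrite /= inE negb_or => /and3P[/andP[xy _] _ Us].
  by apply: planar_cons_pair => //; apply: H.
move=> /reducibleP[ri|[i [a [b [d [e [t [_ E ne Lt]]]]]]]].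
  case: c ri U {IH cn} => [|a [|b [|c [|d [|e [|f []]]]]]] // /orP[].
  - by move=> /andP[ab cd] U; do 2![apply: (add2) => // ?].
  - by move=> /andP[bc da]; rewrite -(rot_uniq 1) => U; apply: (unrot 1);
      do 2![apply: (add2) => // ?].
  - by move=> /and3P[ab cd ef] U; do 3![apply: (add2) => // ?].
  - by move=> /and3P[ab cd ef]; rewrite -(rot_uniq 1) => U; apply: (unrot 1);
      do 3![apply: (add2) => // ?].
move: U; rewrite -(rot_uniq i) E => U; apply: (unrot i); rewrite E.
have [||pt nt] := IH t _ _ Lt.
- by have := size_rot i c; rewrite E /=; move: cn; lia.
- by case/and5P: U.
have Ul : uniq [:: a; b; d; e].
  by move: U; apply: (@subseq_uniq _ _ ([:: a; b; d; e] ++ _)); apply: prefix_subseq.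
have [/andP[/eqP pa _] _] := andP ne.
have pK : fpf_involution p [:: a; b; d; e].
  apply: (@fpf_involution_mem p ([:: a; e] ++ [:: b; d])).
    by move=> x; rewrite !inE; do 4!case: (x == _).
  move: Ul; rewrite /= !inE !negb_or -!andbA => /and5P[_ _ ae bd _].
  by case/andP: ne => ? ?; apply: (@fpf_involution_cat p [:: a; e]); apply: fpf_involution2.
have nK : planar p [:: a; b; d; e].
  move=> x y; apply/negP => sub.
  (* A crossing would fill all four places, making [d] the partner of [a] instead of [e]. *)
  have /eqP[xa _ px _] : [:: x; y; p x; p y] == [:: a; b; d; e].
    by have /leqifP := size_subseq_leqif sub; case: ifP.
  by move: Ul; rewrite -px xa pa /= !inE eqxx /= !andbF.
split; first exact: (@fpf_involution_cat p [:: a; b; d; e]).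
exact: (@planar_cat p [:: a; b; d; e]).
Qed.

(** * Cyclic labels and the matching left by a removed block *)

Lemma rot_iota i n : i <= n ->
  rot i (iota 0 n) = [seq (i + j) %% n | j <- iota 0 n].
Proof.
move=> ni; rewrite /rot drop_iota take_iota (minn_idPl ni) add0n.
rewrite -{3}(subnK ni) iotaD map_cat add0n; congr (_ ++ _).
  rewrite -{1}[i]addn0 iotaDl; apply/eq_in_map => j; rewrite mem_iota => /andP[_ jn].
  by rewrite modn_small //; lia.
rewrite -{1}[n - i]addn0 iotaDl -map_comp -[LHS]map_id.
apply/eq_in_map => j; rewrite mem_iota => /andP[_ jn] /=.
by rewrite (_ : i + (n - i + j) = n + j) ?modnDl ?modn_small //; lia.
Qed.

Lemma rot_iota_block i n : 4 <= n -> i < n ->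
  rot i (iota 0 n) =
  [:: i, (i + 1) %% n, (i + 2) %% n, (i + 3) %% n &
      [seq (i + 4 + j) %% n | j <- iota 0 (n - 4)]].
Proof.
move=> n4 i_n; rewrite rot_iota ?(ltnW i_n) // -{2}(subnKC n4) iotaD map_cat /= addn0 modn_small //.
do 4!congr cons; rewrite add0n (iotaDl 4 0) -map_comp; apply: eq_map => j /=.
by rewrite addnA.
Qed.

Lemma perfect_matchingP n s :
  reflect (size s = n /\ fpf_involution (nth 0 s) (iota 0 n)) (is_perfect_matching n s).
Proof.
apply: (iffP andP) => -[] /eqP sn ps; split=> //.
  move=> i iin; have /and3P[h1 h2 /eqP h3] := allP ps _ iin.
  by rewrite mem_iota.
apply/allP => i iin; have [h1 h2 h3] := ps i iin.
by move: h1; rewrite mem_iota h3 => /= ->; rewrite h2 /=.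
Qed.

Lemma ring_map g p p' (P : pred nat) s :
  (forall a b, P a -> P b -> linked p (g a) (g b) = linked p' a b) ->
  all P s -> ring p (map g s) = ring p' s.
Proof.
move=> lk.
case: s => [|a [|b [|c [|d [|e [|f [|h s]]]]]]] //=.
  by move=> /and5P[? ? ? ? _]; rewrite !lk.
by move=> /and5P[? ? ? ? /and3P[? ? _]]; rewrite !lk.
Qed.

(** The map [g] undoes the relabelling in [remove_block], so the smaller matching is the old one
    conjugated by [g]. *)
Lemma remove_block_perfect n i s (g := fun j => (i + 4 + j) %% n) :
  4 <= n -> i < n -> is_perfect_matching n s ->
  nested (nth 0 s) i ((i + 1) %% n) ((i + 2) %% n) ((i + 3) %% n) ->
  [/\ is_perfect_matching (n - 4) (remove_block n s i),
      {in iota 0 (n - 4) &, injective g} &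
      forall j, j < n - 4 -> nth 0 s (g j) = g (nth 0 (remove_block n s i) j)].
Proof.
move=> n4 i_n /perfect_matchingP[sn ps] ne.
have E : rot i (iota 0 n) =
    [:: i; (i + 1) %% n; (i + 2) %% n; (i + 3) %% n] ++ map g (iota 0 (n - 4)).
  exact: rot_iota_block.
have U : uniq (rot i (iota 0 n)) by rewrite rot_uniq iota_uniq.
have gn j : g j < n by rewrite ltn_pmod //; lia.
have g_inj : {in iota 0 (n - 4) &, injective g}.
  move=> j j'; rewrite !mem_iota => /andP[_ jn] /andP[_ j'n] /eqP.
  by rewrite eqn_modDl !modn_small => [/eqP| |]; lia.
(* Partners of block points lie in the block, so a kept point has a kept partner. *)
have gP j : j < n - 4 -> exists2 j', j' < n - 4 & nth 0 s (g j) = g j'.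
  move=> jn; have jin : g j \in map g (iota 0 (n - 4)) by rewrite map_f // mem_iota.
  have [] := ps (g j); first by rewrite mem_iota gn.
  rewrite -(mem_rot i) E mem_cat => /orP[|/mapP[j' + ->] _ _]; last first.
    by rewrite mem_iota; exists j'.
  move=> H pp; exfalso; move: U; rewrite E cat_uniq => /and3P[_ /hasPn/(_ _ jin) + _].
  rewrite -pp; case/andP: ne => /andP[/eqP p1 /eqP p2] /andP[/eqP p3 /eqP p4].
  move: H; rewrite !inE => /or4P[] /eqP->;
    by rewrite ?p1 ?p2 ?p3 ?p4 eqxx ?orbT.
have rE j j' : j < n - 4 -> j' < n - 4 -> nth 0 s (g j) = g j' ->
    nth 0 (remove_block n s i) j = j'.
  move=> jn j'n pj; rewrite (nth_map 0) ?size_iota // nth_iota // add0n modnDml pj.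
  have q : (i + 4) %% n < n by rewrite ltn_pmod //; lia.
  rewrite /g -modnDml -addnBA; last exact: ltnW.
  rewrite modnDml (_ : _ + _ + _ = j' + n); last by lia.
  by rewrite modnDr modn_small //; lia.
have pE j : j < n - 4 -> nth 0 s (g j) = g (nth 0 (remove_block n s i) j).
  by move=> jn; have [j' j'n pj] := gP j jn; rewrite (rE j j').
split=> //; apply/perfect_matchingP; split; first by rewrite size_map size_iota.
move=> j; rewrite mem_iota => /andP[_ jn].
have [j' j'n pj] := gP j jn; rewrite (rE j j') // mem_iota /= j'n.
have gin : g j \in iota 0 n by rewrite mem_iota gn.
have [_ pp pne] := ps (g j) gin; split=> //.
  by apply: rE => //; rewrite -pj pp.
by apply: contra_neq pne => jj; rewrite pj jj.
Qed.

Lemma isLk_L_reducible k s : is_perfect_matching k.*2 s ->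
  isLk k s = L_reducible (nth 0 s) (iota 0 k.*2).
Proof.
(* With fewer than eight points a removal leaves fewer than four, so only rings qualify. *)
have small (p : nat -> nat) c : size c < 8 -> L_reducible p c = ring p c.
  move=> c8; apply/idP/idP => [|/reducible_base//].
  move=> /reducibleP[//|[i [a [b [d [e [t [_ E ne /L_reducible_size Lt]]]]]]]].
  by have := size_rot i c; rewrite E /=; move: c8 Lt; lia.
have [n] := ubnP k; elim: n k s => // n IH [|[|[|[|k]]]] s kn.
- by [].
- by rewrite small.
- rewrite small // => _; rewrite /= /is_ring /linked /=.
  by rewrite !andbT; congr (_ || _); do !case: eqP.
- rewrite small // => _; rewrite /= /is_ring /linked /=.
  by rewrite !andbT; congr (_ || _); do !case: eqP.
have -> : isLk k.+4 s = has (fun i =>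
    has_block_at k.+4.*2 s i && isLk k.+2 (remove_block k.+4.*2 s i))
  (iota 0 k.+4.*2) by [].
move: kn; set m := k.+4 => kn pm; have mE : m = k.+4 by [].
clearbody m; have m8 : 8 <= m.*2 by lia.
rewrite reducibleE size_iota.
have -> : ring (nth 0 s) (iota 0 m.*2) = false.
  by apply/negP => /ring_size; rewrite size_iota; lia.
apply: eq_in_has => i; rewrite mem_iota => /andP[_ im]; rewrite add0n in im.
set g := fun j => (i + 4 + j) %% m.*2.
have -> : rot i (iota 0 m.*2) =
    [:: i, (i + 1) %% m.*2, (i + 2) %% m.*2, (i + 3) %% m.*2 &
     map g (iota 0 (m.*2 - 4))].
  by apply: rot_iota_block => //; lia.
have -> : has_block_at m.*2 s i =
    nested (nth 0 s) i ((i + 1) %% m.*2) ((i + 2) %% m.*2) ((i + 3) %% m.*2).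
  rewrite /has_block_at modn_small // /nested /linked.
  have /perfect_matchingP[_ ps] := pm.
  (* [has_block_at] tests each edge from one end; the involution supplies the other direction. *)
  have lk x y : x < m.*2 -> (nth 0 s x == y) && (nth 0 s y == x) = (nth 0 s x == y).
    move=> xm; case: eqP => //= <-; have [|_ -> _] := ps x; first by rewrite mem_iota.
    exact: eqxx.
  by rewrite !lk // ltn_pmod //; lia.
case ne : (nested _ _ _ _ _); last by [].
rewrite !andTb.
have [|pr g_inj pg] := remove_block_perfect m.*2 i s _ im pm ne; first by lia.
move: g_inj pg; rewrite -/g => g_inj pg.
have m4 : m.*2 - 4 = (k.+2).*2 by lia.
move: pr g_inj pg; rewrite m4 => pr g_inj pg; rewrite IH //; last by move: kn; lia.
have /perfect_matchingP[_ pr'] := pr.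
have lk a b : a \in iota 0 (k.+2).*2 -> b \in iota 0 (k.+2).*2 ->
    linked (nth 0 s) (g a) (g b) = linked (nth 0 (remove_block m.*2 s i)) a b.
  have gE x y : x \in iota 0 (k.+2).*2 -> y \in iota 0 (k.+2).*2 ->
      (nth 0 s (g x) == g y) = (nth 0 (remove_block m.*2 s i) x == y).
    move=> xi yi; rewrite pg; last by move: xi; rewrite mem_iota.
    by have [ri _ _] := pr' x xi; rewrite -/g (inj_in_eq g_inj).
  by move=> ai bi; rewrite /linked !gE.
rewrite (reducible_map _ _ g (fun j => j \in iota 0 (k.+2).*2) _ _
  (nested (nth 0 (remove_block m.*2 s i))) (ring (nth 0 (remove_block m.*2 s i)))) //.
- by move=> a b c d ai bi ci di; rewrite /nested !lk.
- by move=> c; apply: ring_map.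
Qed.

(** * Counting *)

Lemma closed_word_marks p (s : seq (nat * bool)) : closed_word p s -> 4 * count snd s = size s.
Proof.
have [n] := ubnP (size s); elim: n s => // n IH s sn.
move=> /reducibleP[/nilP-> //|[i [a [b [c [d [t [_ E op rt]]]]]]]].
have := size_rot i s; have := count_rot _ (@snd nat bool) i s.
case/andP: op => _ /and4P[/= a2 /negbTE b2 /negbTE c2 /negbTE d2].
rewrite E /= a2 b2 c2 d2 => cE sE.
by have := IH t _ rt; move: sn sE cE; lia.
Qed.

Lemma ringed_word_marks p (s : seq (nat * bool)) : ringed_word p s ->
  4 * count snd s + 4 = size s \/ 4 * count snd s + 6 = size s.
Proof.
have [n] := ubnP (size s); elim: n s => // n IH s sn.
move=> /reducibleP[/andP[ri un]|[i [a [b [c [d [t [_ E op rt]]]]]]]].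
  have -> : count snd s = 0.
    by apply/eqP; rewrite -leqn0 leqNgt -has_count; rewrite -all_predC.
  by have := ring_size _ _ ri; rewrite size_map; lia.
have := size_rot i s; have := count_rot _ (@snd nat bool) i s.
case/andP: op => _ /and4P[/= a2 /negbTE b2 /negbTE c2 /negbTE d2].
rewrite E /= a2 b2 c2 d2 => cE sE.
by have := IH t _ rt; move: sn sE cE; lia.
Qed.

Lemma count_snd_zip (T : Type) (s : seq T) (u : seq bool) :
  size u <= size s -> count snd (zip s u) = count id u.
Proof. by move=> us; rewrite -[in RHS](unzip2_zip us) count_map. Qed.

Definition partner n (f : {ffun 'I_n -> 'I_n}) : nat -> nat := nth 0 (mseq f).

Lemma partnerE n (f : {ffun 'I_n -> 'I_n}) (i : 'I_n) : partner n f i = f i.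
Proof.
by rewrite /partner /mseq (nth_map i) ?size_enum_ord // nth_ord_enum.
Qed.

Lemma size_mseq n (f : {ffun 'I_n -> 'I_n}) : size (mseq f) = n.
Proof. by rewrite size_map size_enum_ord. Qed.

Lemma subseq4_iota n a b c d : a < b -> b < c -> c < d -> d < n ->
  subseq [:: a; b; c; d] (iota 0 n).
Proof.
move=> ab bc cd dn.
suff -> : [:: a; b; c; d] = filter (mem [:: a; b; c; d]) (iota 0 n).
  exact: filter_subseq.
apply: (irr_sorted_eq ltn_trans ltnn); first by rewrite /= ab bc cd.
  by apply: sorted_filter (iota_ltn_sorted 0 n); apply: ltn_trans.
move=> x; rewrite mem_filter mem_iota /= !inE.
by case: (_ || _) / idP => //= /or4P[] /eqP->; lia.
Qed.

Lemma matching_L_reducible k (f : {ffun 'I_k.*2 -> 'I_k.*2}) :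
  is_matching k.*2 (mseq f) && isLk k (mseq f) =
  L_reducible (partner k.*2 f) (iota 0 k.*2).
Proof.
apply/andP/idP => [[/andP[pm _]]|L]; first by rewrite isLk_L_reducible.
have [ps np] := L_reducible_planar _ _ (iota_uniq 0 k.*2) L.
have pm : is_perfect_matching k.*2 (mseq f).
  by apply/perfect_matchingP; rewrite size_mseq.
rewrite isLk_L_reducible // /is_matching pm; split=> //.
apply/allP => a _; apply/allP => b _; apply/allP => c _; apply/allP => d.
rewrite mem_iota => /andP[_ dn].
apply/negP => /and5P[ab bc cd /eqP pa /eqP pb].
by have := np a b; rewrite /partner pa pb subseq4_iota.
Qed.

(** Compatible functions on [nat] are restricted to the finite type. The default of [insubd] never
    shows, since [stable] keeps the values below [n]. *)
Lemma card_partner n (base : (nat -> nat) -> pred (seq (nat * bool))) N s :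
  (forall p q s, {in map fst s, p =1 q} -> base p s = base q s) ->
  (forall p, reducible (opened p) (base p) s -> forall x, x < n -> p x < n) ->
  map fst s = iota 0 n -> partner_count base N s ->
  #|[set f | reducible (opened (partner n f)) (base (partner n f)) s]| = N.
Proof.
move=> base_ext stable sE [P [P1 P2 P3]].
pose F i := [ffun x : 'I_n => insubd x (P i x)].
have FE i : {in map fst s, partner n (F i) =1 P i}.
  move=> x; rewrite sE mem_iota => /andP[_ xn].
  rewrite -[x]/(val (Ordinal xn)) partnerE ffunE val_insubd.
  by rewrite (stable (P i)) ?P1.
have -> : [set f | reducible (opened (partner n f)) (base (partner n f)) s] =
    F @: [set: 'I_N].
  apply/setP => f; rewrite inE; apply/idP/imsetP => [/P3[i fP]|[i _ ->]].
    exists i => //; apply/ffunP => x; apply: val_inj.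
    have xs : val x \in map fst s by rewrite sE mem_iota /=.
    by rewrite /= -!partnerE fP // FE.
  by rewrite (reducible_opened_ext _ base_ext _ (P i)).
rewrite card_imset ?cardsT ?card_ord // => i j Fij.
by apply: P2 => x xs; rewrite -!FE // Fij.
Qed.

(** Double counting of the compatible pairs of a matching and a word: [P] selects the words that
    have [N] matchings, the others having none. *)
Lemma sum_count_words k (R : (nat -> nat) -> seq (nat * bool) -> bool) N
    (P : pred (seq bool)) :
  (forall p u, size u = k.*2 -> R p (zip (iota 0 k.*2) u) -> L_reducible p (iota 0 k.*2)) ->
  (forall u, size u = k.*2 ->
    #|[set f | R (partner k.*2 f) (zip (iota 0 k.*2) u)]| = P u * N) ->
  \sum_(f | L_reducible (partner k.*2 f) (iota 0 k.*2))
     count (fun u => R (partner k.*2 f) (zip (iota 0 k.*2) u)) (words k.*2) =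
  count P (words k.*2) * N.
Proof.
move=> RL RP; under eq_bigr do rewrite -sum1_count big_mkcond /=.
rewrite exchange_big /= -sum1_count [in RHS]big_mkcond [RHS]big_distrl /=.
rewrite !big_seq; apply: eq_bigr => u; rewrite mem_words => /eqP su.
transitivity (P u * N); last by case: (P u).
rewrite -RP // -sum1dep_card [in RHS]big_mkcond /= big_mkcond /=.
apply: eq_bigr => f _.
by case: ifP => // /negbT L; case: ifP => // /(RL _ _ su); rewrite (negbTE L).
Qed.

Lemma num_L_matchingsE k :
  num_L_matchings k = \sum_(f | L_reducible (partner k.*2 f) (iota 0 k.*2)) 1.
Proof.
by rewrite /num_L_matchings -sum1dep_card; apply: eq_bigl => f; rewrite matching_L_reducible.
Qed.

Lemma labels_zip n (u : seq bool) : size u = n -> map fst (zip (iota 0 n) u) = iota 0 n.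
Proof. by move=> su; rewrite -/(unzip1 _) unzip1_zip // size_iota su. Qed.

Lemma sum_closed_words k : 0 < k ->
  \sum_(f | L_reducible (partner k.*2 f) (iota 0 k.*2))
     closed_words (partner k.*2 f) (iota 0 k.*2) =
  count (fun u => 4 * count id u == k.*2) (words k.*2).
Proof.
move=> k0; rewrite -[RHS]muln1.
have RL p u : size u = k.*2 -> closed_word p (zip (iota 0 k.*2) u) -> L_reducible p (iota 0 k.*2).
  move=> su /closed_word_L; rewrite labels_zip // /nilp size_zip size_iota su minnn.
  (* The empty word is closed without being L-reducible; [k0] rules it out. *)
  by case: k k0 {su}.
under eq_bigr do rewrite /closed_words size_iota.
apply: (sum_count_words k (fun p => closed_word p)) => // u su.
have sz : size (zip (iota 0 k.*2) u) = k.*2 by rewrite size_zip size_iota su minnn.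
have cz : count snd (zip (iota 0 k.*2) u) = count id u.
  by rewrite count_snd_zip // size_iota su.
case: eqP => [cu|cu]; last first.
  rewrite mul0n; apply/eqP; rewrite cards_eq0; apply/eqP/setP => f; rewrite !inE.
  by apply/negP => /closed_word_marks; rewrite cz sz.
apply: (card_partner _ (fun _ => @nilp _)) => //; first 1 last.
- exact: labels_zip.
- by apply: partner_count_nil; rewrite ?labels_zip ?iota_uniq ?cz ?sz.
move=> p /(RL _ _ su) /(L_reducible_planar _ _ (iota_uniq 0 _))[ps _] x xk.
by have [] := ps x; rewrite !mem_iota.
Qed.

Lemma sum_ringed_words k :
  \sum_(f | L_reducible (partner k.*2 f) (iota 0 k.*2))
     ringed_words (partner k.*2 f) (iota 0 k.*2) =
  count (fun u => (4 * count id u + 4 == k.*2) || (4 * count id u + 6 == k.*2))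
    (words k.*2) * 2.
Proof.
have RL p u : size u = k.*2 -> ringed_word p (zip (iota 0 k.*2) u) -> L_reducible p (iota 0 k.*2).
  by move=> su /ringed_word_L_reducible; rewrite labels_zip.
under eq_bigr do rewrite /ringed_words size_iota.
apply: (sum_count_words k (fun p => ringed_word p)) => // u su.
have sz : size (zip (iota 0 k.*2) u) = k.*2 by rewrite size_zip size_iota su minnn.
have cz : count snd (zip (iota 0 k.*2) u) = count id u.
  by rewrite count_snd_zip // size_iota su.
case: (boolP (_ || _)) => cu; last first.
  rewrite mul0n; apply/eqP; rewrite cards_eq0; apply/eqP/setP => f; rewrite !inE.
  by apply/negP => /ringed_word_marks; rewrite cz sz => -[] /eqP E; rewrite E ?orbT in cu.
apply: (card_partner _ unmarked_ring).
- by move=> p q r pq; rewrite /unmarked_ring (ring_ext p q).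
- move=> p /(RL _ _ su) /(L_reducible_planar _ _ (iota_uniq 0 _))[ps _] x xk.
  by have [] := ps x; rewrite !mem_iota.
- exact: labels_zip.
- apply: partner_count_ring; rewrite ?labels_zip ?iota_uniq ?cz ?sz //.
  by case/orP: cu => /eqP; auto.
Qed.

Lemma num_L_matchings_even m :
  num_L_matchings m.+1.*2 + 2 * 'C(4 * m.+1, m) = 'C(4 * m.+1, m.+1).
Proof.
set k := m.+1.*2; have n4 : k.*2 = 4 * m.+1 by rewrite /k; lia.
have k0 : 0 < k by []; clearbody k.
have nRE := sum_ringed_words k; have nCE := sum_closed_words k k0.
rewrite mulnC -n4 -[in RHS]count_words_bin.
under eq_count do rewrite -(eqn_pmul2l (isT : 0 < 4)) -n4.
rewrite -nCE -count_words_bin.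
(* Modulo 4 only the ring on four points can occur, and it leaves [m] marks. *)
rewrite (@eq_count _ _ (fun u =>
  (4 * count id u + 4 == k.*2) || (4 * count id u + 6 == k.*2))); last first.
  by move=> u /=; rewrite n4; lia.
rewrite -nRE num_L_matchingsE -big_split /=; apply: eq_bigr => f L.
have := L_reducible_count _ _ L (iota_uniq _ _); rewrite size_iota.
have -> : 4 %| k.*2 by rewrite n4 dvdn_mulr.
by rewrite addn0 addnC.
Qed.

Lemma num_L_matchings_odd m : num_L_matchings m.+1.*2.+1 = 2 * 'C(4 * m + 6, m).
Proof.
set k := m.+1.*2.+1; have n4 : k.*2 = 4 * m + 6 by rewrite /k; lia.
clearbody k.
have nRE := sum_ringed_words k.
rewrite mulnC -n4 -count_words_bin.
(* Here only the ring on six points can occur, again with [m] marks. *)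
rewrite (@eq_count _ _ (fun u =>
  (4 * count id u + 4 == k.*2) || (4 * count id u + 6 == k.*2))); last first.
  by move=> u /=; rewrite n4; lia.
rewrite -nRE num_L_matchingsE; apply: eq_bigr => f L.
have N4 : ~~ (4 %| k.*2) by rewrite n4; lia.
have := L_reducible_count _ _ L (iota_uniq _ _).
by rewrite size_iota (negbTE N4) closed_words_ndvd4 ?size_iota // addn0.
Qed.

(** * Closed formulas over the rationals *)

Local Open Scope ring_scope.

Theorem mainTheorem14 (k : nat) (hk : (1 <= k)%N) :
  let l := uphalf k in
  (odd k ->
     (num_L_matchings k)%:R =
       (2%:R / 3%:R) * ((l.-1)%:R / l%:R) * ('C((4 * l - 2)%N, l.-1))%:R :> rat) /\
  (~~ odd k ->
     (num_L_matchings k)%:R =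
       (l.+1)%:R / ((3 * l).+1)%:R * ('C((4 * l)%N, l))%:R :> rat).
Proof.
move=> l; split=> k_odd.
  have kE : k = l.-1.*2.+1 by rewrite /l uphalf_half k_odd -{1}(odd_double_half k) k_odd.
  move: kE; have : (0 < l)%N by rewrite /l uphalf_half k_odd.
  case: (l) => [|[|m]] // _ -> /=.
    (* For size 1 both sides vanish: [isLk] is false and the factor [l.-1] is zero. *)
    rewrite !(mul0r, mulr0); apply/eqP; rewrite pnatr_eq0 cards_eq0.
    by apply/eqP/setP => f; rewrite !inE andbF.
  rewrite num_L_matchings_odd.
  have -> : (4 * m.+2 - 2 = 4 * m + 6)%N by lia.
  (* The ratio of consecutive binomials raises the lower index from [m] to [m.+1], which is
     [l.-1]. *)
  have := congr1 (fun x => x%:R : rat) (mul_bin_left (4 * m + 6) m).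
  have -> : (4 * m + 6 - m = 3 * m.+2)%N by lia.
  rewrite !natrM => bE.
  have m0 : (m.+2)%:R != 0 :> rat by rewrite pnatr_eq0.
  have -> : 'C(4 * m + 6, m)%:R = m.+1%:R * 'C(4 * m + 6, m.+1)%:R / (3%:R * m.+2%:R) :> rat.
    by rewrite bE mulrC mulKf // mulf_neq0.
  by field; rewrite -natrD pnatr_eq0.
have kE : k = l.*2 by rewrite /l uphalf_half (negbTE k_odd) -{1}(odd_double_half k) (negbTE k_odd).
move: hk; rewrite {k_odd}kE; case: (l) => [|m] // _.
have /(congr1 (fun x => x%:R : rat)) := num_L_matchings_even m.
have := congr1 (fun x => x%:R : rat) (mul_bin_left (4 * m.+1) m).
have -> : (4 * m.+1 - m = (3 * m.+1).+1)%N by lia.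
rewrite natrD !natrM => bE nE.
have m0 : (3 * m.+1).+1%:R != 0 :> rat by rewrite pnatr_eq0.
(* With [l] equal to [m.+1], multiplying by [3 * l + 1] turns the lower binomial into [l] times the
   upper one, and [3 * l + 1 - 2 * l] is [l + 1]. *)
apply: (mulfI m0).
have -> : (num_L_matchings m.+1.*2)%:R = 'C(4 * m.+1, m.+1)%:R - 2%:R * 'C(4 * m.+1, m)%:R :> rat.
  by rewrite -nE addrK.
rewrite mulrBr (mulrCA _ 2%:R) -bE [RHS]mulrA [X in _ = X * _]mulrC divfK //.
by ring.
Qed.
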